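(* Let $\Gamma$ be a graph. If $\Gamma$ does not contain an embedded copy of the four-cycle $C_4$, then the graph group $G(\Gamma)$ does not contain an embedded copy of $G(C_4)$; that is, $G(\Gamma)$ has no subgroup isomorphic to $G(C_4)$.
   Context: A graph $\Gamma$ is a set $V(\Gamma)$ of vertices together with a reflexive, symmetric relation $E(\Gamma) \subseteq V(\Gamma) \times V(\Gamma)$; vertices $u,v$ are adjacent if $(u,v) \in E(\Gamma)$. An embedding of graphs is a map on vertices which is injective and preserves both adjacency and non-adjacency; so an embedded copy of $C_4$ in $\Gamma$ is an induced subgraph of $\Gamma$ isomorphic to $C_4$. The graph group $G(\Gamma)$ is the group with presentation $\langle V(\Gamma) \mid ab = ba \text{ for all } (a,b) \in E(\Gamma) \rangle$. $C_4$ is the four-cycle: four vertices $v_1, v_2, v_3, v_4$ where, among pairs of distinct vertices, exactly $\{v_1,v_2\}, \{v_2,v_3\}, \{v_3,v_4\}, \{v_4,v_1\}$ are adjacent. ($G(C_4)$ is a direct product of two free groups of rank $2$.) *)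

(* Defs.v *)
(* MathComp; [boolp] makes the quotient by an undecidable congruence a type. *)
From HB Require Import structures.
From mathcomp Require Import all_boot.
From mathcomp Require Import boolp.

Set Implicit Arguments.
Unset Strict Implicit.
Unset Printing Implicit Defensive.

(* [(x, false)] stands for the generator x and [(x, true)] for x^-1. *)
Definition word (X : Type) : Type := seq (X * bool).

HB.instance Definition _ (X : Type) := gen_eqMixin (word X).
HB.instance Definition _ (X : Type) := gen_choiceMixin (word X).

Section Presentation.
Variables (X : Type) (R : word X -> word X -> Prop).

(* The least congruence on words that contains the defining relations [R] and
   the free cancellations x x^-1 = x^-1 x = 1. *)
Inductive pres_eq : word X -> word X -> Prop :=
| pres_rel u v : R u v -> pres_eq u v
| pres_cancel x b : pres_eq [:: (x, b); (x, ~~ b)] [::]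
| pres_cat u u' v v' :
    pres_eq u u' -> pres_eq v v' -> pres_eq (u ++ v) (u' ++ v')
| pres_refl u : pres_eq u u
| pres_sym u v : pres_eq u v -> pres_eq v u
| pres_trans u v w : pres_eq u v -> pres_eq v w -> pres_eq u w.

Definition pres_eqb (u v : word X) : bool := `[< pres_eq u v >].

Lemma pres_eqb_refl : reflexive pres_eqb.
Proof. by move=> u; apply/asboolP/pres_refl. Qed.

Lemma pres_eqb_sym : symmetric pres_eqb.
Proof. by move=> u v; apply/idP/idP => /asboolP/pres_sym/asboolP. Qed.

Lemma pres_eqb_trans : transitive pres_eqb.
Proof.
by move=> v u w /asboolP uv /asboolP vw; apply/asboolP/(pres_trans uv vw).
Qed.

Canonical pres_equiv := EquivRel pres_eqb
  pres_eqb_refl pres_eqb_sym pres_eqb_trans.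

(* The group < X | u = v for all (u, v) in R >. *)
Definition presented : Type := {eq_quot pres_equiv}%qT.

HB.instance Definition _ := Choice.on presented.
HB.instance Definition _ : EqQuotient _ pres_equiv presented :=
  EqQuotient.on presented.

Definition pres_class (w : word X) : presented := (\pi_presented w)%qT.

Lemma pres_classP u v : pres_class u = pres_class v <-> pres_eq u v.
Proof.
split=> [/eqmodP /asboolP //|uv].
by apply/eqmodP/asboolP.
Qed.

Lemma pres_classK (g : presented) : pres_class (repr g) = g.
Proof. exact: reprK. Qed.

Definition word_inv (w : word X) : word X :=
  rev [seq (a.1, ~~ a.2) | a <- w].

Lemma word_invK : involutive word_inv.
Proof.
move=> w; rewrite /word_inv map_rev revK -map_comp -[RHS]map_id.
by apply: eq_map => -[x b] /=; rewrite negbK.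
Qed.

Lemma pres_eq_mulwV w : pres_eq (w ++ word_inv w) [::].
Proof.
elim: w => [|[x b] w IHw]; first exact: pres_refl.
have ->: ((x, b) :: w) ++ word_inv ((x, b) :: w) =
    [:: (x, b)] ++ (w ++ word_inv w) ++ [:: (x, ~~ b)].
  by rewrite /word_inv /= rev_cons -cats1 !catA.
apply: pres_trans (pres_cancel x b).
apply: (pres_cat (u' := [:: (x, b)])); first exact: pres_refl.
by rewrite -[X in pres_eq _ X]cat0s; apply: pres_cat; last exact: pres_refl.
Qed.

Lemma pres_eq_mulVw w : pres_eq (word_inv w ++ w) [::].
Proof. by rewrite -{2}(word_invK w); apply: pres_eq_mulwV. Qed.

Lemma pres_eq_inv u v : pres_eq u v -> pres_eq (word_inv u) (word_inv v).
Proof.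
move=> uv; apply: (@pres_trans _ (word_inv u ++ (v ++ word_inv v))).
  rewrite -{1}[word_inv u]cats0; apply: pres_cat; first exact: pres_refl.
  exact/pres_sym/pres_eq_mulwV.
rewrite catA -[X in pres_eq _ X]cat0s; apply: pres_cat; last exact: pres_refl.
apply: pres_trans (pres_eq_mulVw u).
by apply: pres_cat; [exact: pres_refl | exact: pres_sym].
Qed.

Definition pres_mul (g h : presented) : presented :=
  pres_class (repr g ++ repr h).
Definition pres_inv (g : presented) : presented :=
  pres_class (word_inv (repr g)).
Definition pres_one : presented := pres_class [::].

Lemma pres_mulE u v :
  pres_mul (pres_class u) (pres_class v) = pres_class (u ++ v).
Proof. by apply/pres_classP/pres_cat; apply/pres_classP/pres_classK. Qed.

Lemma pres_invE u : pres_inv (pres_class u) = pres_class (word_inv u).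
Proof. by apply/pres_classP/pres_eq_inv/pres_classP/pres_classK. Qed.

Lemma pres_mulA : associative pres_mul.
Proof.
move=> g h k; rewrite -(pres_classK g) -(pres_classK h) -(pres_classK k).
by rewrite !pres_mulE catA.
Qed.

Lemma pres_mul1g : left_id pres_one pres_mul.
Proof. by move=> g; rewrite -(pres_classK g) pres_mulE. Qed.

Lemma pres_mulg1 : right_id pres_one pres_mul.
Proof. by move=> g; rewrite -(pres_classK g) pres_mulE cats0. Qed.

Lemma pres_mulVg : left_inverse pres_one pres_inv pres_mul.
Proof.
move=> g; rewrite -(pres_classK g) pres_invE pres_mulE.
exact/pres_classP/pres_eq_mulVw.
Qed.

Lemma pres_mulgV : right_inverse pres_one pres_inv pres_mul.
Proof.
move=> g; rewrite -(pres_classK g) pres_invE pres_mulE.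
exact/pres_classP/pres_eq_mulwV.
Qed.

HB.instance Definition _ := isGroup.Build presented
  pres_mulA pres_mul1g pres_mulg1 pres_mulVg pres_mulgV.

End Presentation.

(* Possibly infinite, and reflexive: every vertex is adjacent to itself. *)
Record graph := Graph {
  vertex : Type;
  adj : vertex -> vertex -> Prop;
  adj_refl : forall u, adj u u;
  adj_sym : forall u v, adj u v -> adj v u
}.

Definition graph_embedding (D G : graph) (f : vertex D -> vertex G) : Prop :=
  injective f /\ forall u v, adj u v <-> adj (f u) (f v).

Definition contains_graph (G D : graph) : Prop :=
  exists f : vertex D -> vertex G, graph_embedding f.

Inductive commutation_rel (G : graph) :
  word (vertex G) -> word (vertex G) -> Prop :=
| Commutation a b : adj a b ->
    commutation_rel [:: (a, false); (b, false)] [:: (b, false); (a, false)].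

Definition graph_group (G : graph) : groupType :=
  presented (@commutation_rel G).

Definition C4_adj (i j : 'I_4) : Prop :=
  [\/ i = j, j = i.+1 %[mod 4] | i = j.+1 %[mod 4]].

Lemma C4_adj_refl i : C4_adj i i.
Proof. exact: Or31. Qed.

Lemma C4_adj_sym i j : C4_adj i j -> C4_adj j i.
Proof. by case=> [->|ij|ij]; [exact: Or31 | exact: Or33 | exact: Or32]. Qed.

Definition C4 : graph := Graph C4_adj_refl C4_adj_sym.

(* f is an isomorphism from K onto the subgroup H of G. *)
Definition isom_onto (K G : groupType) (H : {pred G})
    (f : {multiplicative K -> G}) : Prop :=
  injective f /\ forall y, y \in H <-> exists x, f x = y.

Definition has_subgroup_isom (G K : groupType) : Prop :=
  exists H : {pred G}, group_closed H /\
    exists f : {multiplicative K -> G}, isom_onto H f.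

(* Main.v *)
Require Import Defs.
From mathcomp Require Import all_boot.
From mathcomp Require Import boolp zify.

(* Let a, c commute with b, d, while neither [a, c] nor [b, d] is trivial.
   Conjugate so that g = [a, c] is represented by a word w of minimal length
   among the words of all conjugates of g.  For a letter v of w, G(Gamma) is
   an HNN extension of G(Gamma - v) over G(link v) with stable letter v; by
   minimality g is hyperbolic on the Bass-Serre tree, its centralizer acts by
   translations on the axis of g, and so the commutator [b, d] fixes the axis
   and lies in G(link v).  Retractions onto parabolic subgroups make
   commutators of elements of G(clique) vanish.  Hence the letters of w are
   not a clique, giving non-adjacent u, v in w; and as [b, d] is in
   G(link u) and G(link v), the set link u :&: link v is not a clique
   either, giving non-adjacent x, y.  The vertices u, x, v, y span a C4. *)

Set Implicit Arguments.
Unset Strict Implicit.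
Unset Printing Implicit Defensive.

Local Open Scope group_scope.

Lemma commuteR (T : groupType) (x y z : T) :
  commute x y -> commute x z -> commute x [~ y, z].
Proof.
by move=> xy xz; do !apply: commuteM => //; do ?apply: commuteV.
Qed.

(** * Homomorphisms out of a graph group *)

Section Ghom.
Variables (D : graph) (T : groupType) (phi : vertex D -> T).
Hypothesis phi_comm : forall u v, adj u v -> commute (phi u) (phi v).

Definition ghom_letter (a : vertex D * bool) : T :=
  if a.2 then (phi a.1)^-1 else phi a.1.

Definition ghom_word (w : word (vertex D)) : T :=
  foldr (fun a x => ghom_letter a * x) 1 w.

Lemma ghom_word_cat u v : ghom_word (u ++ v) = ghom_word u * ghom_word v.
Proof. by elim: u => [|a u IHu] /=; rewrite ?mul1g // IHu mulgA. Qed.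

Lemma ghom_word_eq u v :
  pres_eq (@commutation_rel D) u v -> ghom_word u = ghom_word v.
Proof.
elim=> {u v} [_ _ [a b ab]|x [] /=|u u' v v' _ IHu _ IHv|//|u v _ ->|u v w _ -> _ ->] //=.
- by rewrite !mulg1; apply: phi_comm.
- by rewrite /ghom_letter /= mulg1 mulVg.
- by rewrite /ghom_letter /= mulg1 mulgV.
- by rewrite !ghom_word_cat IHu IHv.
Qed.

Definition ghom (x : graph_group D) : T := ghom_word (repr x).

Lemma ghom_class w : ghom (pres_class _ w) = ghom_word w.
Proof. exact/ghom_word_eq/pres_classP/pres_classK. Qed.

Lemma ghomM : {morph ghom : x y / x * y}.
Proof. by move=> x y; rewrite [x * y]/(pres_mul x y) ghom_class ghom_word_cat. Qed.

Lemma ghom1 : ghom 1 = 1.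
Proof. exact: ghom_class. Qed.

Lemma ghomV : {morph ghom : x / x^-1}.
Proof.
by move=> x; apply: (@mulgI _ (ghom x)); rewrite -ghomM !mulgV ghom1.
Qed.

Lemma ghomR x y : ghom [~ x, y] = [~ ghom x, ghom y].
Proof. by rewrite /commg /conjg !(ghomM, ghomV). Qed.

Lemma commute_ghom z x : (forall u, commute z (phi u)) -> commute z (ghom x).
Proof.
move=> zphi; rewrite /ghom; elim: (repr x) => [|[u b] w IHw] /=.
  exact: commute1.
apply: commuteM IHw; rewrite /ghom_letter; case: b => //=.
exact/commuteV/zphi.
Qed.

End Ghom.

(** * Parabolic subgroups and their retractions *)

Section GraphGroup.
Variable D : graph.
Local Notation V := (vertex D).
Local Notation G := (graph_group D).

Definition cls (w : word V) : G := pres_class (@commutation_rel D) w.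
Definition gen (u : V) : G := cls [:: (u, false)].

Lemma cls_cat u v : cls (u ++ v) = cls u * cls v.
Proof. by rewrite [RHS]pres_mulE. Qed.

Lemma cls_repr x : cls (repr x) = x.
Proof. exact: pres_classK. Qed.

Lemma cls_cons a w : cls (a :: w) = cls [:: a] * cls w.
Proof. by rewrite -cls_cat. Qed.

Lemma cls_letter a : cls [:: a] = ghom_letter gen a.
Proof.
case: a => u [] //; rewrite /ghom_letter /=.
by apply/esym/mulg1_eq; rewrite -cls_cat; apply/pres_classP/(pres_cancel _ u false).
Qed.

Lemma gen_comm u v : adj u v -> commute (gen u) (gen v).
Proof.
move=> uv; rewrite /commute -!cls_cat.
by apply/pres_classP/pres_rel/Commutation.
Qed.

Lemma cls_letter_neg u b : cls [:: (u, ~~ b)] = (cls [:: (u, b)])^-1.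
Proof. by rewrite !cls_letter; case: b; rewrite /ghom_letter /= ?invgK. Qed.

Definition par_gen (S : V -> Prop) (u : V) : G :=
  if `[< S u >] then gen u else 1.
(** The retraction onto the parabolic subgroup G(S); the equation [par S x = x] serves throughout as
    membership in G(S). *)
Definition par (S : V -> Prop) : G -> G := ghom (par_gen S).

Lemma par_gen_comm S u v : adj u v -> commute (par_gen S u) (par_gen S v).
Proof.
move=> uv; rewrite /par_gen; case: asboolP => _; last exact/commute_sym/commute1.
by case: asboolP => _; [apply: gen_comm | apply: commute1].
Qed.

Lemma parM S : {morph par S : x y / x * y}.
Proof. exact/ghomM/par_gen_comm. Qed.
Lemma par1 S : par S 1 = 1.
Proof. exact/ghom1/par_gen_comm. Qed.
Lemma parV S : {morph par S : x / x^-1}.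
Proof. exact/ghomV/par_gen_comm. Qed.
Lemma parR S x y : par S [~ x, y] = [~ par S x, par S y].
Proof. exact/ghomR/par_gen_comm. Qed.
Lemma par_cls S w : par S (cls w) = ghom_word (par_gen S) w.
Proof. exact/ghom_class/par_gen_comm. Qed.

Lemma par_letter S a :
  par S (cls [:: a]) = if `[< S a.1 >] then cls [:: a] else 1.
Proof.
rewrite par_cls cls_letter /= mulg1 /ghom_letter /par_gen.
by case: asboolP => _ //; rewrite invg1 if_same.
Qed.

Lemma par_letterT (S : V -> Prop) a : S a.1 -> par S (cls [:: a]) = cls [:: a].
Proof. by move=> Sa; rewrite par_letter asboolT. Qed.

Lemma par_letterF (S : V -> Prop) a : ~ S a.1 -> par S (cls [:: a]) = 1.
Proof. by move=> Sa; rewrite par_letter asboolF. Qed.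

Lemma cls_ind (P : G -> Prop) :
  P 1 -> (forall a x, P x -> P (cls [:: a] * x)) -> forall x, P x.
Proof.
move=> P1 PM x; rewrite -(cls_repr x); elim: (repr x) => [//|a w IHw].
by rewrite cls_cons; apply: PM.
Qed.

(** Hence an element of both G(S) and G(S') lies in the parabolic subgroup of the intersection. *)
Lemma par_par (S S' : V -> Prop) x :
  par S (par S' x) = par (fun u => S u /\ S' u) x.
Proof.
elim/cls_ind: x => [|a x IHx]; first by rewrite !par1.
rewrite !parM IHx; congr (_ * _); rewrite [par S' _]par_letter.
case: asboolP => S'a; last by rewrite par1 par_letterF // => -[].
rewrite !par_letter; congr (if _ then _ else _).
by apply: asbool_equiv_eq; split=> // -[].
Qed.

Definition conj_min (w : word V) : Prop :=
  forall w' x, cls w' = cls w ^ x -> size w <= size w'.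

Fixpoint supp (w : word V) (u : V) : Prop :=
  if w is a :: w' then u = a.1 \/ supp w' u else False.

Lemma par_cls_id (S : V -> Prop) w :
  (forall u, supp w u -> S u) -> par S (cls w) = cls w.
Proof.
elim: w => [_|a w IHw Sw]; first exact: par1.
rewrite cls_cons parM IHw => [|u wu]; last by apply: Sw; right.
by rewrite par_letterT //; apply: Sw; left.
Qed.

Lemma commute_par S z x :
  (forall u, S u -> commute z (gen u)) -> commute z (par S x).
Proof.
move=> zS; apply: commute_ghom => u; rewrite /par_gen.
by case: asboolP => [/zS //|_]; apply: commute1.
Qed.

Lemma par_clique_comm (S : V -> Prop) x y :
  (forall u v, S u -> S v -> adj u v) -> commute (par S x) (par S y).
Proof.
move=> cliS; apply: commute_par => v Sv; apply: commute_sym.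
by apply: commute_par => u Su; apply/gen_comm/cliS.
Qed.

(** The retraction turns the commutator into a commutator of the abelian group G(S), so x and y
    themselves may lie anywhere. *)
Lemma commg_par_clique (S : V -> Prop) x y :
  (forall u v, S u -> S v -> adj u v) -> par S [~ x, y] = [~ x, y] ->
  [~ x, y] = 1.
Proof. by move=> cliS <-; rewrite parR; apply/eqP/commgP/par_clique_comm. Qed.

Lemma commute_letter_par S v b x :
  (forall u, S u -> adj v u) -> commute (cls [:: (v, b)]) (par S x).
Proof.
move=> vS; apply: commute_sym.
have cv : commute (par S x) (gen v).
  by apply/commute_sym/commute_par => u Su; apply/gen_comm/vS.
by rewrite cls_letter /ghom_letter; case: b => //=; apply: commuteV.
Qed.

End GraphGroup.

(** * The action on the Bass-Serre tree of the splitting along v *)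

Section Tree.
Variables (D : graph) (v : vertex D).
Local Notation V := (vertex D).
Local Notation G := (graph_group D).

Definition link (u : V) : Prop := adj v u /\ u <> v.
Definition off (u : V) : Prop := u <> v.

(* The subgroup generated by the conjugates of v under G(off) is free on
   G(off) / G(link).  [edge] encodes its basis elements and their inverses
   (cosets are predicates on G), and reduced sequences of edges, read as paths
   from the root, encode the vertices of the Bass-Serre tree. *)
Definition edge : Type := (G -> Prop) * bool.

Definition link_coset (y : G) : Prop := par link y = y.
Definition flip (e : edge) : edge := (e.1, ~~ e.2).
Definition trans (x : G) (e : edge) : edge := (fun y => e.1 (x^-1 * y), e.2).
Definition no_cancel (e f : edge) : bool := ~~ `[< f = flip e >].
Definition reduced (P : seq edge) : bool := sorted no_cancel P.

Definition push (e : edge) (P : seq edge) : seq edge :=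
  if P is f :: P' then if `[< f = flip e >] then P' else e :: P else [:: e].

(** G is the semidirect product of the free normal subgroup and G(off), and acts on the free part: v
    multiplies on the left, while every other generator conjugates, which permutes the basis. *)
Definition step (a : V * bool) (P : seq edge) : seq edge :=
  if `[< a.1 = v >] then push (link_coset, a.2) P
  else map (trans (cls [:: a])) P.

Definition act_word (w : word V) (P : seq edge) : seq edge := foldr step P w.
Definition act (x : G) (P : seq edge) : seq edge := act_word (repr x) P.

Lemma flipK : involutive flip.
Proof. by case=> A b; rewrite /flip /= negbK. Qed.

Lemma trans1 e : trans 1 e = e.
Proof.
case: e => A b; congr (_, _); apply/funext => y /=.
by rewrite invg1 mul1g.
Qed.

Lemma transM x y e : trans (x * y) e = trans x (trans y e).
Proof.
case: e => A b; congr (_, _); apply/funext => z /=.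
by rewrite invgM mulgA.
Qed.

Lemma transK x : cancel (trans x) (trans x^-1).
Proof. by move=> e; rewrite -transM mulVg trans1. Qed.

Lemma trans_inj x : injective (trans x).
Proof. exact: can_inj (transK x). Qed.

Lemma trans_flip x e : trans x (flip e) = flip (trans x e).
Proof. by []. Qed.

Lemma no_cancel_trans x e f :
  no_cancel (trans x e) (trans x f) = no_cancel e f.
Proof.
congr (~~ _); apply: asbool_equiv_eq; rewrite -trans_flip.
by split=> [/trans_inj|->].
Qed.

Lemma reduced_trans x P : reduced (map (trans x) P) = reduced P.
Proof.
rewrite /reduced sorted_map; apply: eq_sorted => e f.
exact: no_cancel_trans.
Qed.

Lemma map_trans_push x e P :
  map (trans x) (push e P) = push (trans x e) (map (trans x) P).
Proof.
case: P => [|f P] //=.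
have -> : `[< trans x f = flip (trans x e) >] = `[< f = flip e >].
  by apply: negb_inj; apply: no_cancel_trans.
by case: ifP.
Qed.

Lemma reduced_tail e P : reduced (e :: P) -> reduced P.
Proof. exact: path_sorted. Qed.

Lemma reduced_cat_cons P e Q :
  reduced (P ++ [:: e]) -> reduced (e :: Q) -> reduced (P ++ e :: Q).
Proof.
by case: P => [//|f P]; rewrite /reduced /= !cat_path /= andbT => /andP[-> ->].
Qed.

Lemma reduced_push e P : reduced P -> reduced (push e P).
Proof.
case: P => [|f P] //= rP; case: asboolP => [_|fe]; first exact: path_sorted rP.
by rewrite /reduced /= rP andbT; apply/asboolPn.
Qed.

Lemma pushK e P : reduced P -> push e (push (flip e) P) = P.
Proof.
case: P => [|f P] rP /=; first by rewrite asboolT.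
case: asboolP => [fe|_] /=; last by rewrite asboolT.
move: rP; rewrite {f}fe flipK; case: P => [|g P] //= /andP[/asboolPn eg _].
by rewrite asboolF.
Qed.

Lemma reduced_step a P : reduced P -> reduced (step a P).
Proof.
rewrite /step; case: ifP => _; first exact: reduced_push.
by rewrite reduced_trans.
Qed.

Lemma reduced_act_word w P : reduced P -> reduced (act_word w P).
Proof. by elim: w => //= a w IHw /IHw/reduced_step. Qed.

Lemma act_word_cat u w P : act_word (u ++ w) P = act_word u (act_word w P).
Proof. by rewrite /act_word foldr_cat. Qed.

Lemma trans_link_coset x b :
  par link x = x -> trans x (link_coset, b) = (link_coset, b).
Proof.
move=> Kx; congr (_, _); apply/funext => y; apply/propext => /=.
rewrite /link_coset parM parV Kx; split=> [/mulgI //|->//].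
Qed.

Lemma cls_off u b : u <> v -> par off (cls [:: (u, b)]) = cls [:: (u, b)].
Proof. by move=> uv; rewrite par_letterT. Qed.

(** The case that matters is v against a neighbour: translation by an element of G(link) fixes the
    coset G(link). *)
Lemma step_comm u w P : adj u w ->
  step (u, false) (step (w, false) P) = step (w, false) (step (u, false) P).
Proof.
have link_comm x : adj v x -> x <> v ->
    step (v, false) (step (x, false) P) = step (x, false) (step (v, false) P).
  move=> vx xv; rewrite /step asboolT //= asboolF // map_trans_push.
  by rewrite trans_link_coset // par_letterT.
have [->|uv] := pselect (u = v); have [->|wv] := pselect (w = v) => // uw.
- exact: link_comm.
- by rewrite link_comm //; apply: adj_sym.
rewrite /step !asboolF // -!map_comp; apply: eq_map => e /=.
by rewrite -!transM; congr (trans _ e); apply: gen_comm.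
Qed.

Lemma step_cancel u b P : reduced P -> step (u, b) (step (u, ~~ b) P) = P.
Proof.
move=> rP; rewrite /step /=; case: asboolP => [uv|_]; first exact: pushK.
rewrite -map_comp -[RHS]map_id; apply: eq_map => e /=.
by rewrite -transM cls_letter_neg mulgV trans1.
Qed.

Lemma act_word_eq u w : pres_eq (@commutation_rel D) u w ->
  forall P, reduced P -> act_word u P = act_word w P.
Proof.
elim=> {u w} [_ _ [x y xy]|x b|u u' w w' _ IHu _ IHw|//|u w _ IHu|u w z _ IHu _ IHw]
  P rP //=.
- exact: step_comm.
- exact: step_cancel.
- by rewrite !act_word_cat IHw // IHu // reduced_act_word.
- by rewrite IHu.
- by rewrite IHu // IHw.
Qed.

Lemma act_cls w P : reduced P -> act (cls w) P = act_word w P.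
Proof. by move=> rP; apply: act_word_eq rP; apply/pres_classP/pres_classK. Qed.

Lemma reduced_act x P : reduced P -> reduced (act x P).
Proof. exact: reduced_act_word. Qed.

Lemma actM x y P : reduced P -> act (x * y) P = act x (act y P).
Proof.
move=> rP; rewrite -(cls_repr x) -(cls_repr y) -cls_cat.
by rewrite !act_cls ?act_word_cat ?reduced_act.
Qed.

Lemma act1 P : reduced P -> act 1 P = P.
Proof. by move=> rP; rewrite (act_cls [::]). Qed.

Lemma act_inj x P Q : reduced P -> reduced Q -> act x P = act x Q -> P = Q.
Proof.
move=> rP rQ PQ; rewrite -(act1 rP) -(act1 rQ) -(mulVg x).
by rewrite !actM // PQ.
Qed.

(** * Vertex and edge stabilizers *)

(* [path_value P y]: y is the element of the free normal subgroup whose reduced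
   form is P.  A relation avoids choosing coset representatives. *)
Inductive path_value : seq edge -> G -> Prop :=
| path_value_nil : path_value [::] 1
| path_value_cons h b P y : par off h = h -> path_value P y ->
    path_value (trans h (link_coset, b) :: P) (cls [:: (v, b)] ^ h^-1 * y).

Lemma path_value_trans h P y : par off h = h -> path_value P y ->
  path_value (map (trans h) P) (y ^ h^-1).
Proof.
move=> offh; elim=> {P y} [|k b P y offk _ IHP] /=.
  by rewrite conj1g; apply: path_value_nil.
rewrite conjMg -conjgM -invgM -transM.
by apply: path_value_cons => //; rewrite parM offh offk.
Qed.

Lemma trans_link_cosetP h b b' : trans h (link_coset, b) = (link_coset, b') ->
  par link h = h /\ b = b'.
Proof.
case=> Kh ->; split=> //; rewrite -[_ = _]/(link_coset h) -Kh mulVg.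
exact: par1.
Qed.

Lemma path_value_push b P y : path_value P y ->
  path_value (push (link_coset, b) P) (cls [:: (v, b)] * y).
Proof.
have cons_val Q z : path_value Q z ->
    path_value ((link_coset, b) :: Q) (cls [:: (v, b)] * z).
  by move/(path_value_cons b (par1 off)); rewrite trans1 invg1 conjg1.
case=> [|h c Q z offh Qz]; first exact/cons_val/path_value_nil.
(* Cancellation occurs only if h lies in G(link); then h commutes with v, so the values cancel as
   well. *)
rewrite /push; case: asboolP => [/trans_link_cosetP[Kh ->]|_]; last first.
  exact/cons_val/path_value_cons.
rewrite cls_letter_neg conjVg mulgA.
suff -> : cls [:: (v, b)] ^ h^-1 = cls [:: (v, b)] by rewrite mulgV mul1g.
apply/conjg_fixP/commgP/commuteV; rewrite -Kh.
by apply: commute_letter_par => u [].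
Qed.

(** This is the semidirect decomposition of x: the path from the root to its image spells the free
    factor y. *)
Lemma act_path_value x :
  exists2 y, path_value (act x [::]) y & x = y * par off x.
Proof.
elim/cls_ind: x => [|[u b] x [y xy defx]].
  by exists 1; rewrite ?act1 // ?par1 ?mulg1 //; apply: path_value_nil.
rewrite actM // act_cls ?reduced_act //= /step parM /=.
case: asboolP => [->|uv].
  exists (cls [:: (v, b)] * y); first exact: path_value_push.
  by rewrite par_letterF ?mul1g -?mulgA -?defx // => /(_ erefl).
have offu := cls_off b uv; exists (y ^ (cls [:: (u, b)])^-1).
  exact: path_value_trans.
by rewrite offu conjgE invgK !mulgA mulgVK -mulgA -defx.
Qed.

Lemma stab_root x : act x [::] = [::] -> par off x = x.
Proof.
move=> x0; have [y] := act_path_value x; rewrite x0 => y0 {2}->.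
by inversion y0; rewrite mul1g.
Qed.

Lemma act_off x P : reduced P -> act (par off x) P = map (trans (par off x)) P.
Proof.
move=> rP; elim/cls_ind: x => [|[u b] x IHx].
  by rewrite par1 act1 // (eq_map trans1) map_id.
rewrite parM; have [->|uv] := pselect (u = v).
  by rewrite par_letterF ?mul1g // => /(_ erefl).
rewrite cls_off // actM // act_cls ?reduced_act //= IHx /step asboolF //.
by rewrite -map_comp; apply: eq_map => e /=; rewrite transM.
Qed.

(** By [stab_root], x is in G(off), which acts by translating cosets; to fix the coset G(link) is
    then to lie in it. *)
Lemma stab_edge x b : act x [::] = [::] ->
  act x [:: (link_coset, b)] = [:: (link_coset, b)] -> par link x = x.
Proof.
move/stab_root => offx; rewrite -{1}offx act_off // offx.
move=> /(congr1 (head (link_coset, b))) xK.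
by have [] := @trans_link_cosetP x b b xK.
Qed.

(** * The effect of the action on long paths *)

(** Each letter removes at most one edge at the front, so a word shorter than P never reaches Q,
    whose edges are at most translated. *)
Lemma act_word_catr w P Q : size w < size P ->
  size P <= size (act_word w P) + size w /\
  exists2 Q', size Q' = size Q & act_word w (P ++ Q) = act_word w P ++ Q'.
Proof.
elim: w => [|a w IHw] /=; first by rewrite addn0; split=> //; exists Q.
move=> wP; have [szP [Q' szQ' ->]] := IHw (ltnW wP).
case: (act_word w P) szP => [|e R] szP.
  by move: szP wP => /=; rewrite add0n ltnNge => /leqW ->.
rewrite /step; case: ifP => _; last first.
  rewrite map_cat size_map; split; first by rewrite addnS leqW.
  by exists (map (trans (cls [:: a])) Q'); rewrite ?size_map.
rewrite /push /=; case: ifP => _; split; try by exists Q'.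
  by rewrite addnS -addSn.
by rewrite /= addnS leqW // addSn leqW.
Qed.

(** Adjacency in the tree: vertices are paths from the root, so neighbours differ by a last edge. *)
Definition nbr (P Q : seq edge) : Prop :=
  exists e, Q = rcons P e \/ P = rcons Q e.

Lemma nbr_sym P Q : nbr P Q -> nbr Q P.
Proof. by case=> e [] ->; exists e; [right | left]. Qed.

Lemma nbr_step a P Q : nbr P Q -> nbr (step a P) (step a Q).
Proof.
wlog [e ->] : P Q / exists e, Q = rcons P e.
  move=> W [e [PQ|QP]]; first by apply: W; exists e => //; left.
  by apply/nbr_sym/W; exists e => //; left.
move=> _; rewrite /step; case: ifP => _; last first.
  by exists (trans (cls [:: a]) e); left; rewrite map_rcons.
case: P => [|f P] /=; last by case: ifP => _; exists e; left.
case: ifP => _; first by exists (link_coset, a.2); right.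
by exists e; left.
Qed.

Lemma nbr_act x P Q : nbr P Q -> nbr (act x P) (act x Q).
Proof.
by rewrite /act; elim: (repr x) => //= a w IHw /IHw/nbr_step.
Qed.

(** The images of the root and of Q are joined by [size Q] edges, and crossing an edge alters only
    the far end of a path. *)
Lemma act_prefix x Q n : n + size Q <= size (act x [::]) ->
  take n (act x Q) = take n (act x [::]).
Proof.
elim/last_ind: Q n => [//|Q e IHQ] n; rewrite size_rcons -addSnnS => szn.
(* One spare edge, in case the last crossing shortens the path. *)
have tQ := IHQ _ szn; have szQ : n < size (act x Q).
  have := congr1 size tQ; rewrite [RHS]size_take_min (minn_idPl _).
    by rewrite size_take_min => <-; apply: geq_minr.
  exact: leq_trans (leq_addr _ _) szn.
have := congr1 (take n) tQ; rewrite !take_takel // => <-.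
have [e' [->|Qe]] := @nbr_act x Q (rcons Q e) (ex_intro _ e (or_introl erefl)).
  by rewrite -cats1 takel_cat // ltnW.
by move: szQ; rewrite Qe size_rcons ltnS -(cats1 (act _ _)) => ?; rewrite takel_cat.
Qed.

(** * Tracks of words and pinches *)

(* The edges crossed by the path from the root that the word w traces in the
   tree; it need not be reduced. *)
Fixpoint track (w : word V) : seq edge :=
  if w is a :: w' then
    if `[< a.1 = v >] then (link_coset, a.2) :: track w'
    else map (trans (cls [:: a])) (track w')
  else [::].

Lemma track_cat u w :
  track (u ++ w) = track u ++ map (trans (par off (cls u))) (track w).
Proof.
elim: u => [|[x b] u IHu] /=.
  by rewrite par1 (eq_map trans1) map_id.
rewrite IHu (cls_cons _ u) parM; case: asboolP => [->|xv].
  by rewrite par_letterF ?mul1g // => /(_ erefl).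
by rewrite cls_off // map_cat -map_comp (eq_map (transM _ _)).
Qed.

Lemma act_word_track w P :
  reduced (track w ++ map (trans (par off (cls w))) P) ->
  act_word w P = track w ++ map (trans (par off (cls w))) P.
Proof.
elim: w => [|[x b] w IHw] /=.
  by rewrite par1 (eq_map trans1) map_id.
rewrite (cls_cons _ w) parM /step /=; case: asboolP => [->|xv] /=.
  rewrite par_letterF ?mul1g => [|/(_ erefl)//] rwP.
  rewrite IHw; last exact: reduced_tail rwP.
  move: rwP; case: (_ ++ _) => //= e R /andP[/asboolPn eR _].
  by rewrite asboolF.
rewrite cls_off // (eq_map (transM _ _)) (map_comp _ (trans _)) -map_cat.
by rewrite reduced_trans => /IHw->.
Qed.

Lemma track_split w e P : track w = e :: P -> exists w1 b w2,
  w = w1 ++ (v, b) :: w2 /\ e = trans (cls w1) (link_coset, b).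
Proof.
elim: w e P => [//|[x b] w IHw] e P /=; case: asboolP => [->|_].
  by case=> <- _; exists [::], b, w; rewrite trans1.
case def_w: (track w) => [//|f Q] [<- _].
have [w1 [c [w2 [-> ->]]]] := IHw _ _ def_w.
by exists ((x, b) :: w1), c, w2; rewrite -transM -cls_cons.
Qed.

(** This is Britton's lemma: consecutive edges are opposite only if the word between their letters v
    fixes the coset G(link), hence lies in it. *)
Lemma track_not_reduced w : ~~ reduced (track w) ->
  exists w1 b w2 w3, w = w1 ++ (v, b) :: w2 ++ (v, ~~ b) :: w3 /\
    par link (cls w2) = cls w2.
Proof.
elim: w => [//|[x b] w IHw] /=; case: asboolP => [->|_]; last first.
  rewrite reduced_trans => /IHw[w1 [c [w2 [w3 [-> Kw2]]]]].
  by exists ((x, b) :: w1), c, w2, w3.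
have [/= rw|/IHw[w1 [c [w2 [w3 [-> Kw2]]]]] _] := boolP (reduced (track w)).
  case def_w: (track w) rw => [//|e P] rP.
  rewrite /reduced /= [X in _ && X]rP andbT negbK => /asboolP def_e.
  have [w2 [c [w3 [-> e_c]]]] := track_split def_w.
  rewrite e_c in def_e; have [Kw2 /= ->] := trans_link_cosetP def_e.
  by exists [::], b, w2, w3.
by exists ((v, b) :: w1), c, w2, w3.
Qed.

Lemma cls_pinch b w u : par link (cls w) = cls w ->
  cls ((v, b) :: w ++ (v, ~~ b) :: u) = cls (w ++ u).
Proof.
move=> Kw; have cw : commute (cls [:: (v, b)]) (cls w).
  by rewrite -Kw; apply: commute_letter_par => x [].
rewrite cls_cons cls_cat (cls_cons _ u) cls_letter_neg !mulgA cw mulgK.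
by rewrite cls_cat.
Qed.

(** A pinch inside the word would shorten it; a pinch using the appended letter would shorten a
    cyclic rotation. That letter covers the seam between successive copies of the word. *)
Lemma conj_min_track b w (vw := (v, b) :: w) :
  conj_min vw -> reduced (track (vw ++ [:: (v, b)])).
Proof.
move=> minw; apply/negPn/negP => /track_not_reduced[w1 [c [w2 [w3 []]]]].
case/lastP: w3 => [|w3 e]; rewrite cats1 /vw.
  rewrite -cat_cons catA cats1 => /rcons_inj[].
  (* With [w1] empty, the ends of the pinch would be the first and the appended letter, which have
     the same sign. *)
  case: w1 => [[<- _]|a w1 [_ def_w]] b_c Kw2; first by case: (b) b_c.
  have /minw : cls (w1 ++ w2) = cls vw ^ cls [:: (v, b)].
    rewrite conjgE /vw (cls_cons _ w) -mulgA mulKg -cls_cat def_w -catA b_c.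
    by rewrite cls_cat [RHS]cls_cat cls_pinch ?cats0.
  by rewrite /= def_w !size_cat /=; lia.
rewrite -!(rcons_cons, rcons_cat) => /rcons_inj[def_w _] Kw2.
have /minw : cls (w1 ++ w2 ++ w3) = cls vw ^ 1.
  by rewrite conjg1 /vw def_w cls_cat [RHS]cls_cat cls_pinch.
rewrite /vw def_w !size_cat /= size_cat /=; lia.
Qed.

(** * The axis of g and the centralizer of g *)

Section Axis.
Variables (b0 : bool) (w0 : word V).
Let w := (v, b0) :: w0.
Let g := cls w.
Hypothesis min_w : conj_min w.

(** The translation length of g, which is the number of letters v in w. *)
Let l := size (track w).

Fact track_w : track w = (link_coset, b0) :: track w0.
Proof. by rewrite /w /= asboolT. Qed.

Fact l_gt0 : 0 < l. Proof. by rewrite /l track_w. Qed.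

Definition wpow n : word V := iter n (cat w) [::].

Definition axis n : seq edge := track (wpow n).
(** The vertex at distance t on the ray from the root through its images under the powers of g. As l
    is positive, [axis t] has at least t edges. *)
Definition axis_pt t : seq edge := take t (axis t).

Lemma axisS n : axis n.+1 = track w ++ map (trans (par off g)) (axis n).
Proof. exact: track_cat. Qed.

Lemma size_axis n : size (axis n) = (n * l)%N.
Proof. by elim: n => // n IHn; rewrite axisS size_cat size_map IHn mulSn. Qed.

Lemma wpowD m n : wpow (m + n) = wpow m ++ wpow n.
Proof. by elim: m => //= m IHm; rewrite IHm -catA. Qed.

Lemma reduced_axis n : reduced (axis n).
Proof.
elim: n => // -[_|n IHn]; rewrite axisS.
  rewrite cats0; have := conj_min_track min_w; rewrite track_cat.
  by case/cat_sorted2.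
have [R def_ax] : exists R, axis n.+1 = (link_coset, b0) :: R.
  by rewrite axisS track_w; eexists.
rewrite def_ax -(reduced_trans (par off g)) in IHn *.
(* Only the seam is left: the edge after [track w] is the one traced by the extra letter in
   [conj_min_track]. *)
apply: reduced_cat_cons IHn; have := conj_min_track min_w.
by rewrite track_cat /= !asboolT.
Qed.

Lemma take_axis t n : t <= size (axis n) -> take t (axis n) = axis_pt t.
Proof.
move=> tn; rewrite /axis_pt.
have tt : t <= size (axis t) by rewrite size_axis leq_pmulr ?l_gt0.
(* Both [axis n] and [axis t] are prefixes of [axis (n + t)]. *)
rewrite -(@takel_cat _ _ (axis n) (map (trans (par off (cls (wpow n)))) (axis t))) //.
rewrite -(@takel_cat _ _ (axis t) (map (trans (par off (cls (wpow t)))) (axis n))) //.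
by rewrite -!track_cat -!wpowD addnC.
Qed.

Lemma size_axis_pt t : size (axis_pt t) = t.
Proof. by rewrite size_takel // size_axis leq_pmulr ?l_gt0. Qed.

Lemma reduced_axis_pt t : reduced (axis_pt t).
Proof. exact/take_sorted/reduced_axis. Qed.

Lemma take_axis_pt s t : s <= t -> take s (axis_pt t) = axis_pt s.
Proof.
move=> st; rewrite /axis_pt take_takel // take_axis // size_axis.
exact: leq_trans st (leq_pmulr _ l_gt0).
Qed.

Lemma axis_pt1 : axis_pt 1 = [:: (link_coset, b0)].
Proof. by rewrite /axis_pt axisS track_w /= take0. Qed.

Lemma act_axis_pt t : act g (axis_pt t) = axis_pt (l + t).
Proof.
have def_gt : track w ++ map (trans (par off g)) (axis_pt t) = axis_pt (l + t).
  have lt : l + t <= size (axis t.+1).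
    by rewrite size_axis mulSn leq_add2l leq_pmulr ?l_gt0.
  rewrite -(take_axis lt) axisS take_cat -/l ltnNge leq_addr /= addKn.
  by rewrite map_take.
rewrite act_cls ?reduced_axis_pt // act_word_track def_gt //.
exact: reduced_axis_pt.
Qed.

Lemma act_axis_ptX n t : act (g ^+ n) (axis_pt t) = axis_pt ((n * l)%N + t).
Proof.
elim: n => [|n IHn]; first by rewrite act1 ?reduced_axis_pt.
by rewrite expgS actM ?reduced_axis_pt // IHn act_axis_pt mulSn addnA.
Qed.

(* Since x g^N = g^N x, the path x (g^N root) = g^N (x root) follows both the
   x-translate of the axis (from some point on) and, up to a bounded end piece,
   the axis itself. *)
Lemma axis_translation x : commute x g ->
  exists i j, forall t, act x (axis_pt (j + t)) = axis_pt (i + t).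
Proof.
move=> xg; set n := size (repr x); pose i := size (act x (axis_pt n.+1)).
(* N makes the ray up to its image point long enough twice: n.+1 + t edges for [xcat], and i + t +
   size (act x [::]) edges for [act_prefix]. *)
exists i, n.+1 => t; pose N := n.+1 + t + i + t + size (act x [::]).
have Nl : N <= (N * l)%N by rewrite leq_pmulr ?l_gt0.
pose A := act x (axis_pt (N * l)%N).
have xcat s u : n < s -> s <= u -> exists2 Q,
    size Q = u - s & act x (axis_pt u) = act x (axis_pt s) ++ Q.
  move=> ns su; have := cat_take_drop s (axis_pt u); rewrite take_axis_pt //.
  move=> <-; have := @act_word_catr (repr x) (axis_pt s) (drop s (axis_pt u)).
  rewrite size_axis_pt => /(_ ns)[_ [Q szQ xQ]].
  by exists Q; rewrite // szQ size_drop size_axis_pt.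
have [|Q szQ xQ] := xcat n.+1 (n.+1 + t) (leqnn _); first exact: leq_addr.
have szxt : size (act x (axis_pt (n.+1 + t))) = i + t.
  by rewrite xQ size_cat szQ addKn.
have [||R _ xR] := xcat (n.+1 + t) (N * l)%N; [exact: leq_addr | lia |].
have -> : act x (axis_pt (n.+1 + t)) = take (i + t) A.
  by rewrite /A xR take_size_cat.
have defA : A = act (g ^+ N) (act x [::]).
  have xgN := commuteX N xg; rewrite /A -[(N * l)%N]addn0 -act_axis_ptX.
  by rewrite -!actM ?xgN.
have gN0 : act (g ^+ N) [::] = axis_pt (N * l)%N by rewrite (act_axis_ptX N 0) addn0.
rewrite defA act_prefix gN0 ?take_axis_pt ?size_axis_pt //; lia.
Qed.

(** The power [g ^+ s] commutes with x and carries every point of the ray into the part that x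
    fixes. *)
Lemma axis_fixed x s : commute x g ->
  (forall t, act x (axis_pt (s + t)) = axis_pt (s + t)) ->
  forall t, act x (axis_pt t) = axis_pt t.
Proof.
move=> xg fix_x t; have {}xg := commuteX s xg; apply: (@act_inj (g ^+ s)).
- exact/reduced_act/reduced_axis_pt.
- exact: reduced_axis_pt.
rewrite -actM ?reduced_axis_pt // -xg actM ?reduced_axis_pt // act_axis_ptX.
have sl : s <= (s * l)%N by rewrite leq_pmulr ?l_gt0.
by rewrite -(subnKC sl) -addnA fix_x.
Qed.

(** Far along the ray x and y both act as shifts, so x y and y x agree there. *)
Lemma commg_centralizer_link x y :
  commute x g -> commute y g -> par link [~ x, y] = [~ x, y].
Proof.
move=> xg yg; have [i [j xij]] := axis_translation xg.
have [i' [j' yij]] := axis_translation yg.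
have fix_c : forall t, act [~ x, y] (axis_pt t) = axis_pt t.
  apply: (@axis_fixed _ (j + j')).
    by apply/commute_sym/commuteR; apply: commute_sym.
  move=> t; apply: (@act_inj (y * x)); [exact/reduced_act/reduced_axis_pt| |].
    exact: reduced_axis_pt.
  rewrite -actM ?reduced_axis_pt // -commgC !actM ?reduced_axis_pt //.
  have -> : j + j' + t = j' + (j + t) by lia.
  rewrite yij addnCA xij [j' + _]addnCA xij [i + (j' + t)]addnCA yij.
  by rewrite addnCA.
(* Fixing the root and the next point of the ray, the commutator fixes the base edge. *)
by apply: (@stab_edge _ b0); rewrite -?axis_pt1 //; apply: (fix_c 0).
Qed.

End Axis.
End Tree.

(** * From commutators to the four-cycle *)

Lemma conj_min_rot D a (w : word (vertex D)) :
  conj_min (a :: w) -> conj_min (w ++ [:: a]).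
Proof.
move=> minw w' x def_w'; rewrite size_cat addn1.
apply: (minw w' (cls [:: a] * x)).
rewrite def_w' conjgM; congr (_ ^ x).
by rewrite cls_cat (cls_cons a w) conjgE -mulgA mulKg.
Qed.

(* Cyclic rotation of w brings each letter to the front; the conjugations
   involved fix the commutator, which commutes with the letters already passed. *)
Lemma supp_commg_link D (w : word (vertex D)) (x y : graph_group D) u :
  conj_min w -> commute x (cls w) -> commute y (cls w) -> supp w u ->
  par (link u) [~ x, y] = [~ x, y].
Proof.
(* Here [w2] collects the letters already rotated to the back. *)
suff rot_link w1 w2 : conj_min (w1 ++ w2) ->
    forall x y, commute x (cls (w1 ++ w2)) -> commute y (cls (w1 ++ w2)) ->
    supp w1 u -> par (link u) [~ x, y] = [~ x, y].
  by have := rot_link w [::]; rewrite cats0 => H /H; apply.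
elim: w1 w2 {x y} => [//|[v b] w1 IHw1] w2 min_w x y xw yw.
have link_v := commg_centralizer_link min_w xw yw.
case=> [-> //|w1u]; set a := cls [:: (v, b)].
have defJ : [~ x, y] ^ a = [~ x, y].
  apply/conjg_fixP/commgP/commute_sym; rewrite -link_v.
  by apply: commute_letter_par => z [].
have rotJ : cls (w1 ++ w2 ++ [:: (v, b)]) = cls (((v, b) :: w1) ++ w2) ^ a.
  by rewrite catA cls_cat [in RHS]cls_cons conjgE -!mulgA mulKg.
rewrite -defJ conjRg; apply: (IHw1 (w2 ++ [:: (v, b)])) => //.
- by rewrite catA; apply: conj_min_rot.
- by rewrite rotJ /commute -!conjMg xw.
- by rewrite rotJ /commute -!conjMg yw.
Qed.

Lemma exists_conj_min D (g : graph_group D) :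
  exists w x, conj_min w /\ cls w = g ^ x.
Proof.
pose P n := `[< exists w x, size w = n /\ cls w = g ^ x >].
have exP : exists n, P n.
  exists (size (repr g)); apply/asboolP; exists (repr g), 1.
  by rewrite cls_repr conjg1.
case: (ex_minnP exP) => n /asboolP[w [x [<- def_w]]] min_n.
exists w, x; split=> // w' y def_w'; apply: min_n; apply/asboolP.
by exists w', (x * y); rewrite def_w' def_w conjgM.
Qed.

Lemma commuting_noncommuting_pairs D (a c b d : graph_group D) :
  commute a b -> commute a d -> commute c b -> commute c d ->
  ~ commute a c -> ~ commute b d ->
  exists u v x y : vertex D, [/\ ~ adj u v, ~ adj x y &
    [/\ adj u x, adj u y, adj v x & adj v y]].
Proof.
move=> ab ad cb cd nac nbd.
have [w [z [min_w def_w]]] := exists_conj_min [~ a, c].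
have commJ t : commute a t -> commute c t -> commute (t ^ z) (cls w).
  move=> at_ ct; rewrite def_w /commute -!conjMg; congr (_ ^ z).
  by apply: commuteR; apply: commute_sym.
have link_supp u : supp w u -> par (link u) [~ b ^ z, d ^ z] = [~ b ^ z, d ^ z].
  by apply: supp_commg_link => //; apply: commJ.
have nJ s t : ~ commute s t -> [~ s ^ z, t ^ z] <> 1.
  by move=> nst; rewrite -conjRg => /eqP; rewrite conjg_eq1 => /commgP.
have [u [v [wu wv nuv]]] : exists u v, [/\ supp w u, supp w v & ~ adj u v].
  apply: contrapT => clique_w; apply: (nJ _ _ nac).
  apply: (@commg_par_clique _ (supp w)) => [u v wu wv|].
    by apply: contrapT => nuv; apply: clique_w; exists u, v.
  by rewrite -conjRg -def_w par_cls_id.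
pose S x := link u x /\ link v x.
have [x [y [[ux vx] [uy vy] nxy]]] : exists x y, [/\ S x, S y & ~ adj x y].
  apply: contrapT => clique_S; apply: (nJ _ _ nbd).
  apply: (@commg_par_clique _ S) => [x y Sx Sy|].
    by apply: contrapT => nxy; apply: clique_S; exists x, y.
  by rewrite -par_par !link_supp.
by exists u, v, x, y; split=> //; case: ux uy vx vy => ? _ [? _] [? _] [? _].
Qed.

Lemma C4_of_pairs D (u v x y : vertex D) : ~ adj u v -> ~ adj x y ->
  [/\ adj u x, adj u y, adj v x & adj v y] -> contains_graph D C4.
Proof.
move=> nuv nxy [ux uy vx vy].
have sym := @adj_sym D; have refl := @adj_refl D.
have nvu : ~ adj v u by move=> /sym.
have nyx : ~ adj y x by move=> /sym.
(* In this cyclic order the non-adjacent pairs u, v and x, y are the diagonals; the default u is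
   never reached. *)
exists (fun i : 'I_4 => nth u [:: u; x; v; y] i).
have emb (i j : 'I_4) : C4_adj i j <->
    adj (nth u [:: u; x; v; y] i) (nth u [:: u; x; v; y] j).
  case: i j => [[|[|[|[|//]]]] ?] [[|[|[|[|//]]]] ?]; split=> //=;
    rewrite /C4_adj /=; by [case=> // /(congr1 val) | auto
      | move=> *; apply: Or31; apply: val_inj
      | move=> *; apply: Or32 | move=> *; apply: Or33].
split=> // i j fij; apply: val_inj; move: fij.
(* A common end of the two diagonals would make x and y adjacent. *)
have [ux_ uy_ vx_ vy_] : [/\ u <> x, u <> y, v <> x & v <> y].
  by split=> e; [apply: nxy | apply: nyx | apply: nxy | apply: nyx]; rewrite -e.
have uv_ : u <> v by move=> e; apply: nuv; rewrite e.
have xy_ : x <> y by move=> e; apply: nxy; rewrite e.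
by case: i j => [[|[|[|[|//]]]] ?] [[|[|[|[|//]]]] ?] //= /esym.
Qed.

(** In the tree of the splitting along u itself, u moves the root. *)
Lemma gen_neq1 D (u : vertex D) : gen u <> 1.
Proof.
move=> u1; have := @act1 _ u [::] erefl.
by rewrite -u1 act_cls //= /step asboolT.
Qed.

(** For distinct u and v, comparing both products on the root of the tree for v shows that u fixes
    the coset G(link v), hence lies in it; the retraction would kill a u not adjacent to v. *)
Lemma commute_gen_adj D (u v : vertex D) : commute (gen u) (gen v) -> adj u v.
Proof.
have [->|uv uvC] := pselect (u = v); first by move=> _; apply: adj_refl.
have := @act_cls _ v ([:: (u, false)] ++ [:: (v, false)]) [::] erefl.
rewrite cls_cat [_ * _]uvC -cls_cat act_cls //= /step /= asboolT // asboolF //=.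
move=> /(congr1 (head (link_coset v, false))) /esym/trans_link_cosetP[Ku _].
apply: contrapT => nuv; apply: (@gen_neq1 _ u); rewrite -[gen u]Ku.
by apply: par_letterF => -[/adj_sym].
Qed.

Theorem corollary9 (Gamma : graph) :
  ~ contains_graph Gamma C4 ->
  ~ has_subgroup_isom (graph_group Gamma) (graph_group C4).
Proof.
move=> noC4 [H [_ [f [f_inj _]]]]; apply: noC4.
pose i k : vertex C4 := inord k : 'I_4.
have fC (j k : vertex C4) : adj j k <-> commute (f (gen j)) (f (gen k)).
  split=> [/gen_comm/gmulf_commute //|fjk].
  by apply/commute_gen_adj/f_inj; rewrite !gmulfM.
have [u [v [x [y [nuv nxy adjs]]]]] :
    exists u v x y : vertex Gamma, [/\ ~ adj u v, ~ adj x y &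
      [/\ adj u x, adj u y, adj v x & adj v y]].
  (* The two non-commuting pairs are the diagonals 0, 2 and 1, 3 of the cycle. *)
  apply: (@commuting_noncommuting_pairs _ (f (gen (i 0))) (f (gen (i 2)))
    (f (gen (i 1%N))) (f (gen (i 3)))).
  - by apply/fC; apply: Or32; rewrite !inordK.
  - by apply/fC; apply: Or33; rewrite !inordK.
  - by apply/fC; apply: Or33; rewrite !inordK.
  - by apply/fC; apply: Or32; rewrite !inordK.
  - by move/fC => [/(congr1 val)||]; rewrite /= !inordK.
  - by move/fC => [/(congr1 val)||]; rewrite /= !inordK.
exact: C4_of_pairs nuv nxy adjs.
Qed.
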